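(* Let $s\ge 1$ be an integer. For all sufficiently large $n$ (depending on $s$), \[ \mathrm{ex}_3(n,\mathrm{Tr}_3(M_{s+1}))=\left\lfloor\frac{s(s+2)}{2}\right\rfloor (n-s-2)+\binom{s+2}{3}. \] Moreover, a $3$-uniform hypergraph $\mathcal{H}$ on $n$ vertices not containing $M_{s+1}$ as a trace attains this number of hyperedges only when $\mathcal{H}$ is constructed as follows: let $G$ be the graph on $s+2$ vertices obtained by removing a minimum edge cover from the complete graph $K_{s+2}$; for each of the remaining $n-(s+2)$ vertices $v$ and every $e\in E(G)$, let $\{v\}\cup e$ be a hyperedge; then add as hyperedges all triples contained in $V(G)$.
   Context: $M_{s+1}$ is the graph (a matching) consisting of $s+1$ pairwise disjoint edges, on $2(s+1)$ vertices. An edge cover of a graph is a set of edges such that every vertex is incident to at least one of them; it is minimum if it has the smallest possible number of edges. Trace: for a hypergraph $\mathcal{H}$ and $S\subseteq V(\mathcal{H})$, the trace of $\mathcal{H}$ on $S$ is the hypergraph $\mathcal{H}_{|S}$ on $S$ with hyperedge set $\{e\cap S: e\in E(\mathcal{H})\}$. $\mathcal{H}$ contains a graph $F$ as a trace if there is $S\subseteq V(\mathcal{H})$ with $|S|=v(F)$ (the number of vertices of $F$) such that $\mathcal{H}_{|S}$ contains $F$ as a sub-hypergraph. $\mathrm{Tr}_r(F)$ denotes the family of minimal $r$-uniform hypergraphs containing $F$ as a trace, and $\mathrm{ex}_r(n,\mathrm{Tr}_r(F))$ is the maximum number of hyperedges in an $r$-uniform hypergraph on $n$ vertices not containing $F$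 as a trace. *)

(* Defs.v *)
From mathcomp Require Import all_boot.

Set Implicit Arguments.
Unset Strict Implicit.
Unset Printing Implicit Defensive.

(* A hypergraph with vertex set the finite type V is its set of hyperedges
   H : {set {set V}}; a graph is a hypergraph whose edges have two elements. *)

Definition uniform (r : nat) (V : finType) (H : {set {set V}}) : bool :=
  [forall e in H, #|e| == r].

Definition trace (V : finType) (H : {set {set V}}) (S : {set V}) :
    {set {set V}} :=
  [set e :&: S | e in H].

(* The hypergraph with vertex set S and hyperedge set H contains a copy of F. *)
Definition has_copy (W V : finType) (F : {set {set W}}) (S : {set V})
    (H : {set {set V}}) : bool :=
  [exists f : {ffun W -> V},
     [&& injectiveb f, [forall x, f x \in S] & [forall e in F, f @: e \in H]]].

Definition contains_trace (W V : finType) (F : {set {set W}})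
    (H : {set {set V}}) : bool :=
  [exists S : {set V}, (#|S| == #|W|) && has_copy F S (trace H S)].

(* ex_r(n, Tr_r(F)) *)
Definition ex_trace (r n : nat) (W : finType) (F : {set {set W}}) : nat :=
  \max_(H : {set {set 'I_n}} | uniform r H && ~~ contains_trace F H) #|H|.

(* k pairwise disjoint edges on 2k vertices. *)
Definition matching (k : nat) : {set {set ('I_k * bool)}} :=
  [set [set (i, false); (i, true)] | i : 'I_k].

Definition complete_graph (V : finType) (U : {set V}) : {set {set V}} :=
  [set e : {set V} | (e \subset U) && (#|e| == 2)].

(* C is an edge cover of the graph with vertex set U and edge set E. *)
Definition edge_cover (V : finType) (U : {set V}) (E C : {set {set V}}) : bool :=
  (C \subset E) && [forall x in U, [exists e in C, x \in e]].

Definition min_edge_cover (V : finType) (U : {set V}) (E C : {set {set V}}) :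
    bool :=
  edge_cover U E C &&
  [forall D : {set {set V}}, edge_cover U E D ==> (#|C| <= #|D|)].

(* The 3-uniform hypergraph built from a graph G with vertex set U. *)
Definition extension (V : finType) (U : {set V}) (G : {set {set V}}) :
    {set {set V}} :=
  [set v |: e | v in ~: U, e in G] :|:
  [set t : {set V} | (t \subset U) && (#|t| == 3)].

(* Main.v *)
Require Import Defs.
From mathcomp Require Import all_boot.
From mathcomp Require Import zify.

Set Implicit Arguments.
Unset Strict Implicit.
Unset Printing Implicit Defensive.

(** A trace of [M_(s+1)] is a family of [s + 1] hyperedges [{a_i, b_i, w_i}] in which
    the [a_i] and [b_i] are all distinct and no [w_i] is one of them.

    Call a pair of vertices heavy when at least [3 (s + 1)] hyperedges contain it.
    In the graph [G] of heavy pairs, a star with centre [c] and [t] leaves gives a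
    trace of [M_t]: each leaf [x] is matched to a fresh vertex [v] such that
    [{c, x, v}] is a hyperedge, and [c] is the dropped vertex every time.  The same
    works for disjoint stars.  Hence, if [H] has no trace of [M_(s+1)], a set of
    vertices dominated in [G] by a disjoint set has at most [s] elements
    ([heavy_star_bound]): the number of vertices exceeds the domination number of
    [G] by at most [s].  By a theorem of Vizing such a graph has at most
    [s (s + 2) / 2] edges ([vizing]), and if it has [floor (s (s + 2) / 2)] edges,
    they lie on [s + 2] vertices [U] and all degrees are at most [s]
    ([vizing_extremal]); in other words, [G] is the complete graph on [U] minus a
    minimum edge cover [C].

    Only boundedly many hyperedges contain no heavy pair ([card_light_edges]), so
    for large [n] a hypergraph with as many hyperedges as claimed must have a
    heavy graph of maximum size ([heavy_graph_structure]).  Every edge of [C] has an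
    end that is covered by no other edge of [C] ([min_edge_cover_leaf]), and this
    end is the centre of a star of [G] with [s] leaves.  A hyperedge that is not in
    the extension of [G] provides one more trace edge beside such a star, so [H] is
    contained in the extension ([confinement]).  The extension has exactly the
    claimed number of hyperedges ([card_extension]), which proves both the upper
    bound and the uniqueness.  Conversely, the extension has no trace of [M_(s+1)]
    because [C] covers [U] ([extension_trace_free]). *)

(** * Traces of matchings *)

Section TraceMatchings.
Variables (V : finType) (H : {set {set V}}).
Implicit Types (l : seq (V * V * V)) (a b w : V).

(** A triple [(a, b, w)] stands for a hyperedge [{a, b, w}] that leaves the trace
    edge [{a, b}] because its apex [w] lies outside the trace set, which is the
    set of the entries of the spine.  Apexes may be repeated. *)
Definition spine l : seq V := flatten [seq [:: t.1.1; t.1.2] | t <- l].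

Definition apexes l : seq V := [seq t.2 | t <- l].

Definition trace_matching l : bool :=
  [&& all (fun t => [set t.1.1; t.1.2; t.2] \in H) l, uniq (spine l)
    & all (fun w => w \notin spine l) (apexes l)].

Lemma size_spine l : size (spine l) = (size l).*2.
Proof. by elim: l => //= t l ->. Qed.

Lemma nth_spine x0 l i (second : bool) : i < size l ->
  nth x0 (spine l) (i.*2 + second) =
  let t := nth (x0, x0, x0) l i in if second then t.1.2 else t.1.1.
Proof. by case: second; elim: l i => [|t l IH] [|i] //= /IH. Qed.

Lemma spine_cons t l : spine (t :: l) = t.1.1 :: t.1.2 :: spine l.
Proof. by []. Qed.

Lemma trace_matching_cons a b w l :
  trace_matching ((a, b, w) :: l) =
  [&& trace_matching l, [set a; b; w] \in H, uniq [:: a; b; w],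
      a \notin spine l ++ apexes l, b \notin spine l ++ apexes l
    & w \notin spine l].
Proof.
rewrite /trace_matching spine_cons /= !mem_cat !inE !negb_or /=.
have -> : all (fun x => x \notin a :: b :: spine l) (apexes l) =
  [&& a \notin apexes l, b \notin apexes l
    & all (fun x => x \notin spine l) (apexes l)].
  elim: (apexes l) => //= x r ->; rewrite !inE !negb_or (eq_sym x a) (eq_sym x b).
  by do ![case: (_ == _); rewrite /= ?andbF //
         | case: (_ \in _); rewrite /= ?andbF //].
rewrite (eq_sym w a) (eq_sym w b) -/(spine l).
do ![case: (_ == _); rewrite /= ?andbF //
    | case: (_ \in _); rewrite /= ?andbF //].
by rewrite andbT.
Qed.

(** The embedding sends the vertex [(i, second)] to the entry of index
    [2 i + second] of the spine, which is injective because the spine has no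
    duplicates. *)
Lemma trace_matching_contains l k :
  trace_matching l -> size l = k -> 0 < k -> contains_trace (matching k) H.
Proof.
move=> /and3P[/allP Hl Ul /allP Al] szl k0.
have [x0 _] : exists x0 : V, true.
  by case: (l) szl k0 => [<-|[[a ? ]?] ? _ _] //; exists a.
pose f := [ffun p : 'I_k * bool => nth x0 (spine l) (p.1.*2 + p.2)].
have lts (p : 'I_k * bool) : p.1.*2 + p.2 < size (spine l).
  by rewrite size_spine szl; case: p => [[i lti] []] /=; lia.
have injf : injective f.
  move=> [i b] [j c]; rewrite !ffunE /= => /eqP.
  rewrite nth_uniq ?(lts (i, b)) ?(lts (j, c)) // => /eqP e.
  have eb : b = c by case: b c e => [] []; lia.
  by congr (_, _) => //; apply: val_inj => /=; move: e; rewrite eb; lia.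
apply/existsP; exists [set x in spine l]; apply/andP; split.
  rewrite cardsE (card_uniqP Ul) size_spine szl card_prod card_ord card_bool.
  by rewrite muln2.
apply/existsP; exists f; apply/and3P; split; first exact/injectiveP.
  by apply/forallP=> p; rewrite ffunE inE mem_nth.
apply/forall_inP => _ /imsetP[i _ ->].
have lti : i < size l by rewrite szl.
set t := nth (x0, x0, x0) l i; have tl : t \in l by apply: mem_nth.
apply/imsetP; exists [set t.1.1; t.1.2; t.2]; first exact: Hl.
rewrite imsetU1 imset_set1 !ffunE.
rewrite (nth_spine x0 false lti) (nth_spine x0 true lti) /= -/t.
have /Al wN : t.2 \in apexes l by apply: map_f.
have aS : t.1.1 \in spine l.
  have := nth_spine x0 false lti; rewrite /= -/t => <-.
  by rewrite mem_nth ?(lts (i, false)).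
have bS : t.1.2 \in spine l.
  have := nth_spine x0 true lti; rewrite /= -/t => <-.
  by rewrite mem_nth ?(lts (i, true)).
apply/setP=> x; rewrite !inE.
case: (x =P t.1.1) => [->|_] /=; first by rewrite aS.
case: (x =P t.1.2) => [->|_] /=; first by rewrite bS.
by case: (x =P t.2) => // ->; rewrite (negbTE wN).
Qed.

(** Third vertices of the hyperedges through a pair [e]; when [H] is 3-uniform
    their number is the codegree of [e]. *)
Definition completions (e : {set V}) : {set V} := [set v | v |: e \in H].

Definition heavy_pairs (K : nat) : {set {set V}} :=
  [set e : {set V} | (#|e| == 2) && (K <= #|completions e|)].

(** The list [D] describes disjoint stars by their pairs (leaf, centre).  A leaf
    [x] with centre [c] contributes the triple [(x, v, c)], where [v] is any fresh
    vertex completing the heavy pair [{x, c}] to a hyperedge: since centres are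
    only ever used as apexes, one centre serves all its leaves.  A triple uses
    three vertices, so at each step fewer than [K] vertices are excluded. *)
Lemma star_extension K l (D : seq (V * V)) :
    trace_matching l -> uniq (unzip1 D) ->
    {in D, forall p, [/\ p.1 \notin spine l ++ apexes l, p.2 \notin spine l,
       p.2 \notin unzip1 D & [set p.1; p.2] \in heavy_pairs K]} ->
    3 * (size l + size D) <= K ->
  exists2 l', trace_matching l' & size l' = size l + size D.
Proof.
elim: D l => [|[x c] D IH] l tl /= UD HD szK; first by exists l; rewrite ?addn0.
have [/= xl cl cD] := HD (x, c) (mem_head _ _).
rewrite inE => /andP[_ Kx]; move: UD => /andP[xD UD].
(* the vertices that the partner of [x] has to avoid *)
pose F := spine l ++ apexes l ++ unzip1 D ++ unzip2 D ++ [:: x; c].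
have [v vH vF] : exists2 v, v \in completions [set x; c] & v \notin F.
  apply/subsetPn; apply/negP => /subset_leq_card cardF.
  have := leq_trans Kx (leq_trans cardF (card_size F)).
  rewrite /F !size_cat size_spine !size_map /=; lia.
move: cD xl vF; rewrite /F !mem_cat !inE !negb_or => /andP[cx cD] /andP[xs xa].
case/and5P=> vs va vD1 vD2 /andP[vx vc].
have tl' : trace_matching ((x, v, c) :: l).
  rewrite trace_matching_cons tl /= !mem_cat !inE !negb_or.
  rewrite xs xa vs va cl (eq_sym x v) vx (eq_sym x c) cx vc !andbT.
  move: vH; rewrite inE; congr (_ \in H).
  by apply/setP=> y; rewrite !inE; case: (y == v); rewrite ?orbT //= orbF.
set l1 := (x, v, c) :: l in tl' *.
suff HD' : {in D, forall p,
    [/\ p.1 \notin spine l1 ++ apexes l1, p.2 \notin spine l1,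
        p.2 \notin unzip1 D & [set p.1; p.2] \in heavy_pairs K]}.
  have szK' : 3 * (size l1 + size D) <= K by rewrite /= addSnnS.
  have [l' tl'' szl'] := IH _ tl' UD HD' szK'.
  by exists l'; rewrite // szl' /= addSnnS.
move=> p pD; have [|hp1 p2s hp3 pG] := HD p; first by rewrite inE pD orbT.
rewrite mem_cat negb_or in hp1; rewrite /= inE negb_or in hp3.
case/andP: hp1 => p1s p1a; case/andP: hp3 => p2x p2D.
have p1D : p.1 \in unzip1 D by apply: map_f.
have p2D' : p.2 \in unzip2 D by apply: map_f.
have n1 : p.1 != x by apply: contraNneq xD => <-.
have n2 : p.1 != v by apply: contraNneq vD1 => <-.
have n3 : p.1 != c by apply: contraNneq cD => <-.
have n4 : p.2 != v by apply: contraNneq vD2 => <-.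
by rewrite pG /l1 spine_cons /= !inE !mem_cat !inE !negb_or p1s p1a
  p2s p2x p2D n1 n2 n3 n4.
Qed.

End TraceMatchings.

(** * Vizing's theorem on domination and number of edges *)

Section Domination.
Variable V : finType.
Implicit Types (g : rel V) (s : nat) (x y u v w : V).

Definition neighbours g x : {set V} := [set y | g x y].

Lemma in_neighbours g x y : (y \in neighbours g x) = g x y.
Proof. by rewrite inE. Qed.

Definition degree g x : nat := #|neighbours g x|.

(** Taking for [D] a minimum dominating set and for [L] its complement, this says
    that the number of vertices minus the domination number is at most [s].  The
    form with two sets passes to subgraphs without any choice of a minimum. *)
Definition star_bound g s : Prop :=
  forall D L : {set V}, [disjoint D & L] ->
    (forall x, x \in L -> exists2 c, c \in D & g c x) -> #|L| <= s.

Definition far g v : {set V} := ~: (v |: neighbours g v).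

Definition induced (W : {set V}) g : rel V :=
  fun x y => [&& x \in W, y \in W & g x y].

(** Edges from [u] to the far side are counted twice, so that summing over the
    neighbours [u] of [v] accounts for both ends of these edges in the sum of all
    degrees. *)
Definition weight g v u : nat := degree g u + #|neighbours g u :&: far g v|.

Section MaxDegree.
Variables (g : rel V) (s : nat) (v : V).
Hypotheses (gC : symmetric g) (gI : irreflexive g) (gs : star_bound g s).
Hypothesis (vmax : forall u, degree g u <= degree g v).
Local Notation N := (neighbours g v).
Local Notation W := (far g v).

Lemma degree_le_bound : degree g v <= s.
Proof.
apply: (gs (D := [set v])) => [|x]; first by rewrite disjoints1 inE gI.
by rewrite inE => gx; exists v => //; rewrite inE.
Qed.

(** The centres [v] and [u] together dominate the other neighbours of [v] and the
    far neighbours of [u]. *)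
Lemma far_neighbours_bound u :
  u \in N -> #|neighbours g u :&: W| + degree g v <= s.+1.
Proof.
move=> uN; have : #|(N :\ u) :|: (neighbours g u :&: W)| <= s.
  apply: (gs (D := [set v; u])).
    rewrite disjoints_subset subUset !sub1set !inE !eqxx !gI !andbF.
    by case: (g v u).
  move=> x; rewrite !inE => /orP[/andP[_ gx]|/andP[gx _]].
    by exists v => //; rewrite !inE eqxx.
  by exists u => //; rewrite !inE eqxx orbT.
have dNA : [disjoint N :\ u & neighbours g u :&: W].
  rewrite disjoints_subset; apply/subsetP=> x; rewrite !inE => /andP[_ ->].
  by rewrite orbT andbF.
rewrite cardsU (disjoint_setI0 dNA) cards0.
by have := cardsD1 u N; rewrite uN /degree; lia.
Qed.

Lemma weight_le u : u \in N -> weight g v u <= s.+1.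
Proof.
move=> uN; have := far_neighbours_bound uN; have := vmax u.
by rewrite /weight; lia.
Qed.

(** Stars found on the far side can be completed by the star of [v], whose leaves
    are all its neighbours. *)
Lemma star_bound_far : star_bound (induced W g) (s - degree g v).
Proof.
move=> D L DL LD.
have LW : L \subset W.
  by apply/subsetP=> x /LD[c _ /and3P[]].
have dNL : [disjoint N & L].
  rewrite disjoints_subset; apply/subsetP=> x xN; rewrite inE.
  by apply: contraL xN => /(subsetP LW); rewrite !inE negb_or => /andP[].
have : #|N :|: L| <= s.
  apply: (gs (D := v |: (D :&: W))).
    rewrite -setI_eq0; apply/eqP/setP=> x; rewrite !inE.
    case: (boolP (x \in L)) => xL; last first.
      by case: (x =P v) => [->|_]; rewrite ?gI //=; case: (g v x); rewrite ?orbT ?andbF.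
    have := subsetP LW _ xL; rewrite !inE negb_or => /andP[/negbTE-> /negbTE->].
    by have := disjointFl DL xL => /= ->.
  move=> x; rewrite !inE => /orP[gx|/LD[c cD /and3P[cW _ gc]]].
    by exists v => //; rewrite !inE eqxx.
  by exists c => //; rewrite in_setU1 in_setI cD cW orbT.
rewrite cardsU (disjoint_setI0 dNL) cards0 /degree; lia.
Qed.

Lemma sum_degree_split :
  \sum_x degree g x = degree g v + \sum_(u in N) weight g v u
                      + \sum_x degree (induced W g) x.
Proof.
have eW : \sum_(x in W) degree g x =
    \sum_(u in N) #|neighbours g u :&: W| + \sum_x degree (induced W g) x.
  rewrite [\sum_x _](bigID (mem W)) /= [X in _ = _ + (_ + X)]big1 ?addn0; last first.
    move=> x xW; apply: eq_card0 => y; rewrite !inE /induced.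
    by rewrite (negbTE xW).
  transitivity (\sum_(x in W) (#|neighbours g x :&: N| + degree (induced W g) x)).
    apply: eq_bigr => x xW; rewrite /degree -(cardsID N).
    congr (_ + _); apply: eq_card => y; rewrite !inE /induced xW /=.
    rewrite !inE; case: eqP => [->|_] //=; move: xW; rewrite !inE negb_or.
    by rewrite (gC x v) => /andP[_ /negbTE->]; rewrite andbF.
  rewrite big_split; congr (_ + _).
  transitivity (\sum_(x in W) \sum_(u in N) (g x u : nat)).
    apply: eq_bigr => x _; rewrite -sum1_card big_mkcond [RHS]big_mkcond.
    by apply: eq_bigr => u _; rewrite !inE andbC; case: (g v u); case: (g x u).
  rewrite exchange_big; apply: eq_bigr => u _.
  rewrite -sum1_card big_mkcond [RHS]big_mkcond.
  apply: eq_bigr => x _; rewrite in_setI in_neighbours (gC x u).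
  by case: (x \in W); case: (g u x).
rewrite (bigID (mem W)) /= eW addnC addnA; congr (_ + _).
rewrite (eq_bigl (mem (v |: N))); last by move=> x; rewrite !inE negbK.
rewrite big_setU1 ?inE ?gI //= -addnA; congr (_ + _).
by rewrite -big_split.
Qed.
End MaxDegree.

Lemma max_degree_vertex g :
  0 < #|V| -> exists v, forall u, degree g u <= degree g v.
Proof.
case/card_gt0P => x0 _; exists [arg max_(x > x0) degree g x].
by case: arg_maxnP => // v _ vmax u; apply: vmax.
Qed.

Lemma induced_sym W g : symmetric g -> symmetric (induced W g).
Proof. by move=> gC x y; rewrite /induced gC; do !case: (_ \in _). Qed.

Lemma induced_irr W g : irreflexive g -> irreflexive (induced W g).
Proof. by move=> gI x; rewrite /induced gI !andbF. Qed.

Lemma sum_weight_le g s v :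
    irreflexive g -> star_bound g s -> (forall u, degree g u <= degree g v) ->
  \sum_(u in neighbours g v) weight g v u <= degree g v * s.+1.
Proof.
move=> gI gs vmax; rewrite [degree g v]/degree -sum_nat_const.
by apply: leq_sum => u; apply: weight_le.
Qed.

(** Vizing's bound on the number of edges in terms of the domination number.  Let
    [v] have maximum degree [d].  Its neighbours have weight at most [s + 1], and
    the far side satisfies the hypothesis with [k = s - d], so by induction the
    sum of the degrees is at most [d + d (s + 1) + k (k + 2)], which equals
    [s (s + 2) - d k]. *)
Lemma vizing g s :
  symmetric g -> irreflexive g -> star_bound g s ->
  \sum_x degree g x <= s * (s + 2).
Proof.
elim/ltn_ind: s g => s IH g gC gI gs.
have [V0|/(max_degree_vertex g) [v vmax]] := posnP #|V|.
  by rewrite big1 // => x; have := max_card (mem [set x]); rewrite cards1 V0.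
have [d0|dpos] := posnP (degree g v).
  by rewrite big1 // => x _; apply/eqP; rewrite -leqn0 -d0.
have ds := degree_le_bound v gI gs.
rewrite (sum_degree_split v gC gI).
have hw := sum_weight_le gI gs vmax.
have lt_s : s - degree g v < s by lia.
have := IH _ lt_s _ (induced_sym _ gC) (induced_irr _ gI) (star_bound_far gI gs).
move: hw dpos ds {lt_s}.
set A := \sum_(_ in _) _; set B := \sum_x _; move: (degree g v) => d.
move=> hw dpos ds hB.
have [k sE] : exists k, s = d + k by exists (s - d); lia.
have {}hB : B <= k * (k + 2) by rewrite sE addKn in hB.
nia.
Qed.

(** A maximum degree [d < s] costs [d (s - d)] in the previous bound.  This exceeds
    the loss by rounding, which is at most 1 and is 0 for [s = 2], the only value
    of [s] for which the cost can be 1. *)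
Lemma vizing_extremal_degree g s v :
    0 < s -> symmetric g -> irreflexive g -> star_bound g s ->
    (forall u, degree g u <= degree g v) ->
    s * (s + 2) %/ 2 * 2 <= \sum_x degree g x ->
  degree g v = s.
Proof.
move=> s0 gC gI gs vmax hs.
have dpos : 0 < degree g v.
  rewrite lt0n; apply: contraL hs => /eqP d0; rewrite big1; last first.
    by move=> x _; apply/eqP; rewrite -leqn0 -d0.
  rewrite -ltnNge; nia.
have ds := degree_le_bound v gI gs.
have hw := sum_weight_le gI gs vmax.
have := vizing (induced_sym (far g v) gC) (induced_irr _ gI)
  (star_bound_far gI gs).
move: hs; rewrite (sum_degree_split v gC gI).
move: hw dpos ds.
set A := \sum_(_ in _) _; set B := \sum_x _; move: (degree g v) => d.
move=> hw dpos ds hs hB.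
have [k sE] : exists k, s = d + k by exists (s - d); lia.
have [k0|kpos] := posnP k; first by lia.
have {}hB : B <= k * (k + 2) by rewrite sE addKn in hB.
(* twice the number of edges is at most s(s+2) - dk *)
have key : s * (s + 2) %/ 2 * 2 + d * k <= s * (s + 2).
  have : d + A + B + d * k <= s * (s + 2) by nia.
  lia.
have [s2|s2] := eqVneq s 2.
  by move: key; rewrite s2 /=; nia.
have dk2 : 2 <= d * k by nia.
lia.
Qed.

Section Extremal.
Variables (g : rel V) (s : nat) (v : V).
Hypotheses (gC : symmetric g) (gI : irreflexive g) (gs : star_bound g s).
Hypotheses (vmax : forall u, degree g u <= degree g v) (dv : degree g v = s).
Hypothesis hs : s * (s + 2) %/ 2 * 2 <= \sum_x degree g x.
Local Notation N := (neighbours g v).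
Local Notation W := (far g v).

Lemma far_independent x y : x \in W -> y \in W -> ~~ g x y.
Proof.
move=> xW yW; apply/negP => gxy; have := star_bound_far (v := v) gI gs.
rewrite dv subnn => /(_ [set x] [set y]); rewrite cards1 disjoints1 in_set1.
have -> : x != y by apply: contraTneq gxy => ->; rewrite gI.
move=> /(_ isT) h; suff: 1 <= 0 by []; apply: h => z /set1P->.
by exists x; rewrite ?in_set1 // /induced xW yW.
Qed.

(** The weights are at most [s + 1] each, and at most one unit in total is lost to
    rounding. *)
Lemma weight_pair u1 u2 : u1 \in N -> u2 \in N -> u1 != u2 ->
  2 * s + 1 <= weight g v u1 + weight g v u2.
Proof.
move=> u1N u2N u12; move: hs; rewrite (sum_degree_split v gC gI) dv.
have := vizing (induced_sym W gC) (induced_irr _ gI) (star_bound_far (v := v) gI gs).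
rewrite dv subnn.
have u2N' : u2 \in N :\ u1 by rewrite !inE eq_sym u12 -in_neighbours.
rewrite (big_setD1 u1) //= (big_setD1 u2) //=.
have : \sum_(u in N :\ u1 :\ u2) weight g v u <= (s - 2) * s.+1.
  have cN : #|N :\ u1 :\ u2| = s - 2.
    by move: dv; rewrite /degree (cardsD1 u1) (cardsD1 u2 (_ :\ _)) u1N u2N'; lia.
  rewrite -cN -sum_nat_const; apply: leq_sum => u; rewrite 2!in_setD1.
  by case/and3P=> _ _; apply: weight_le.
have s2 : 2 <= s.
  by move: dv; rewrite /degree (cardsD1 u1) (cardsD1 u2 (_ :\ _)) u1N u2N'; lia.
set A := \sum_(_ in _) _; set B := \sum_x _ => hA hB hsum.
have : s * (s + 2) <= s * (s + 2) %/ 2 * 2 + 1 by lia.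
have [k sE] : exists k, s = k + 2 by exists (s - 2); lia.
move: hA hB hsum; rewrite sE addnK; nia.
Qed.

(** Without a common non-neighbour of [u1] and [u2] among the remaining neighbours
    of [v], the two centres [u1] and [u2] would dominate these together with [v],
    [w1] and [w2], which are [s + 1] vertices.  A common non-neighbour misses two
    vertices of the neighbourhood of [v], so its weight is not maximum, and its
    weight could not be that close to the maximum without a far neighbour. *)
Lemma common_non_neighbour u1 u2 w1 w2 :
    u1 \in N -> u2 \in N -> w1 \in W -> w2 \in W -> w1 != w2 ->
    g u1 w1 -> g u2 w2 ->
  exists2 x, [/\ x \in N, x != u1 & x != u2] &
    weight g v x <= s /\ exists2 w, w \in W & g x w.
Proof.
move=> u1N u2N w1W w2W w12 g1 g2.
have one_far u : u \in N -> #|neighbours g u :&: W| <= 1.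
  by move=> /(far_neighbours_bound gI gs); lia.
have u12 : u1 != u2.
  apply: contraTneq (one_far _ u1N) => u12; rewrite -ltnNge.
  rewrite (cardsD1 w1) (cardsD1 w2 (_ :\ _)) !in_setD1 !in_setI !in_neighbours.
  by rewrite w1W w2W g1 u12 g2 eq_sym w12.
have NW x : x \in N -> x \notin W by rewrite /far !inE negbK orbC => ->.
have vW : v \notin W by rewrite !inE eqxx.
have vN : v \notin N by rewrite inE gI.
have neqW x y : x \notin W -> y \in W -> x != y by move=> xW; apply: contraTneq => <-.
pose M := N :\ u1 :\ u2.
have cM : #|M| + 2 = s.
  move: dv; rewrite /degree (cardsD1 u1) (cardsD1 u2 (_ :\ _)) u1N !in_setD1.
  by rewrite u2N eq_sym u12 -/M /= addnA addnC.
have [x xM /andP[x1 x2]] : exists2 x, x \in M & ~~ g u1 x && ~~ g u2 x.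
  apply/exists_inP; apply: contraT; rewrite negb_exists_in => /forall_inP hM.
  have sMN : M \subset N by rewrite /M !subDset subsetU ?subsetU ?subxx ?orbT.
  have : #|v |: (w1 |: (w2 |: M))| <= s.
    apply: (gs (D := [set u1; u2])).
      rewrite disjoints_subset subUset !sub1set !in_setC !in_setU1 !negb_or.
      rewrite /M !in_setD1 !eqxx !andbF.
      have Nv u : u \in N -> u != v by move=> uN; apply: contraTneq uN => ->.
      by rewrite !Nv // (neqW u1 w1) ?(neqW u1 w2) ?(neqW u2 w1) ?(neqW u2 w2)
                 ?NW ?andbF.
    move=> x; rewrite !in_setU1 => /or4P[/eqP->|/eqP->|/eqP->|/hM].
    - by exists u1; rewrite ?inE ?eqxx // gC -in_neighbours.
    - by exists u1; rewrite ?inE ?eqxx.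
    - by exists u2; rewrite ?inE ?eqxx ?orbT.
    rewrite negb_and !negbK => /orP[gx|gx].
      by exists u1; rewrite ?inE ?eqxx.
    by exists u2; rewrite ?inE ?eqxx ?orbT.
  have MW y : y \in W -> y \notin M.
    by move=> yW; apply: contraL yW => /(subsetP sMN); apply: NW.
  rewrite !cardsU1 !in_setU1 !negb_or !(neqW v) // w12.
  rewrite (contra (subsetP sMN v) vN) !MW //= -cM !add1n addn2.
  by rewrite ltnn.
have /and3P[xu2 xu1 xN] : [&& x != u2, x != u1 & x \in N] by rewrite -2!in_setD1.
exists x; first by [].
have far_x := one_far x xN.
have deg_x : degree g x + 2 <= s + #|neighbours g x :&: W|.
  have : neighbours g x \subset v |: (M :\ x) :|: (neighbours g x :&: W).
    apply/subsetP=> y gy; rewrite !in_setU !in_setI gy /= in_set1 !in_setD1.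
    rewrite in_neighbours in gy; rewrite [y \in W]inE in_setU1.
    have -> : y != x by apply: contraTneq gy => ->; rewrite gI.
    have -> : y != u1 by apply: contraNneq x1 => <-; rewrite gC.
    have -> : y != u2 by apply: contraNneq x2 => <-; rewrite gC.
    by case: (y == v); case: (y \in N).
  move=> /subset_leq_card; rewrite -/(degree g x).
  move=> /leq_trans/(_ (leq_card_setU _ _)); rewrite cardsU1.
  have := cardsD1 x M; rewrite xM -cM.
  case: (_ \notin _) => /=; clear; lia.
have wx : weight g v x <= s + 2 * #|neighbours g x :&: W| - 2.
  by move: deg_x; rewrite /weight; clear; lia.
have wpair := weight_pair xN u1N xu1.
move: wx wpair far_x (weight_le gI gs vmax u1N) => wx wpair far_x wu1.
split; first by clear - wx far_x; lia.
have /card_gt0P[w] : 0 < #|neighbours g x :&: W|.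
  by clear - wx wpair wu1 cM; lia.
by rewrite in_setI in_neighbours => /andP[]; exists w.
Qed.

(** The common non-neighbour [x] provided by [common_non_neighbour] has a far
    neighbour itself, so the same lemma applies to [x] and one of [u1], [u2].  The
    result is a second vertex of weight below the maximum, against
    [weight_pair]. *)
Lemma one_far_neighbour u1 u2 w1 w2 :
    u1 \in N -> u2 \in N -> w1 \in W -> w2 \in W -> g u1 w1 -> g u2 w2 ->
  w1 = w2.
Proof.
move=> u1N u2N w1W w2W g1 g2; apply/eqP; apply: contraT => w12.
have [x [xN xu1 xu2] [tx [w wW gw]]] :=
  common_non_neighbour u1N u2N w1W w2W w12 g1 g2.
have [u [w' [uN w'W ww' gw']]] :
    exists u w', [/\ u \in N, w' \in W, w != w' & g u w'].
  have [ww1|ww1] := eqVneq w w1; last by exists u1, w1.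
  by exists u2, w2; rewrite ww1.
have [y [yN yx _] [ty _]] := common_non_neighbour xN uN wW w'W ww' gw gw'.
have wyx := weight_pair yN xN yx.
by clear - tx ty wyx; lia.
Qed.

End Extremal.

(** Equality in Vizing's bound: the far side of a vertex of maximum degree spans
    no edge, and only one of its vertices can have neighbours at all. *)
Lemma vizing_extremal g s :
    0 < s -> s + 2 <= #|V| -> symmetric g -> irreflexive g -> star_bound g s ->
    s * (s + 2) %/ 2 * 2 <= \sum_x degree g x ->
  exists U : {set V}, [/\ #|U| = s + 2, forall x y, g x y -> x \in U
    & forall x, degree g x <= s].
Proof.
move=> s0 Vs gC gI gs hs.
have [v vmax] : exists v, forall u, degree g u <= degree g v.
  by apply: max_degree_vertex; lia.
have dv := vizing_extremal_degree s0 gC gI gs vmax hs.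
set N := neighbours g v.
have cvN : #|v |: N| = s.+1 by rewrite cardsU1 inE gI -[#|N|]/(degree g v) dv.
have [w wN hw] : exists2 w, w \in far g v &
    forall x u, u \in N -> x \in far g v -> g u x -> x = w.
  have [/existsP[w /andP[wW /exists_inP[u uN guw]]]|] :=
    boolP [exists w, (w \in far g v) && [exists u in N, g u w]].
    exists w => // x u' u'N xW gx.
    exact: (one_far_neighbour gC gI gs vmax dv hs u'N uN).
  rewrite negb_exists => /forallP noW.
  have cW : s.+1 + #|far g v| = #|V| by rewrite -cvN cardsC.
  have /card_gt0P[w wW] : 0 < #|far g v| by clear - cW Vs; lia.
  exists w => // x u uN xW gx; have := noW x; rewrite xW /= => /exists_inP[].
  by exists u.
exists (w |: (v |: N)); split.
- by rewrite cardsU1 cvN; move: wN; rewrite in_setC => ->; lia.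
- move=> x y gxy; rewrite in_setU1; have [//|xw] := eqVneq x w.
  apply: contraT => xW; have {}xW : x \in far g v by rewrite in_setC.
  have : y \notin far g v.
    by apply: contraL gxy; apply: far_independent gI gs dv _ _ _.
  rewrite in_setC negbK in_setU1 => /orP[/eqP yv|vy].
    by move: xW; rewrite !inE -yv gC gxy orbT.
  by have := hw x y vy xW; rewrite gC => /(_ gxy) /eqP; rewrite (negbTE xw).
by move=> x; rewrite -dv.
Qed.
End Domination.

(** * Edge covers of complete graphs *)

Section Covers.
Variable V : finType.
Implicit Types (U : {set V}) (C G : {set {set V}}).

Lemma complete_graphP U (e : {set V}) :
  reflect (e \subset U /\ #|e| = 2) (e \in complete_graph U).
Proof. by rewrite inE; apply: (iffP andP) => -[-> /eqP]. Qed.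

Lemma card_complete_graph U : #|complete_graph U| = 'C(#|U|, 2).
Proof. exact: cards_draws. Qed.

Lemma edge_coverP U C :
  reflect (C \subset complete_graph U /\
      forall x, x \in U -> exists2 y, y != x & [set x; y] \in C)
    (edge_cover U (complete_graph U) C).
Proof.
apply: (iffP andP) => -[sCK covC]; split=> //.
  move=> x /(forall_inP covC)/exists_inP[e eC xe].
  have /complete_graphP[_ /eqP/cards2P[a [b [ab eE]]]] := subsetP sCK e eC.
  move: xe; rewrite eE => /set2P[->|->]; last first.
    by exists a => //; rewrite setUC -eE.
  by exists b; rewrite 1?eq_sym // -eE.
apply/forall_inP=> x /covC[y _ xyC]; apply/exists_inP.
by exists [set x; y]; rewrite // !inE eqxx.
Qed.

Lemma leq_card_edge_cover U C :
  edge_cover U (complete_graph U) C -> #|U| <= 2 * #|C|.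
Proof.
move=> /edge_coverP[sCK covC].
have : U \subset cover C.
  apply/subsetP=> x /covC[y _ xyC]; apply/bigcupP.
  by exists [set x; y]; rewrite // !inE eqxx.
move=> /subset_leq_card/leq_trans; apply.
apply: leq_trans (leq_card_cover C) _.
rewrite mulnC -sum_nat_const; apply: leq_sum => e /(subsetP sCK).
by move=> /complete_graphP[_ ->].
Qed.

(** A maximum matching covers [U] up to one vertex, which takes one more edge; the
    induction removes two vertices at a time. *)
Lemma small_edge_cover U : 2 <= #|U| ->
  exists2 C : {set {set V}}, edge_cover U (complete_graph U) C
    & 2 * #|C| <= #|U| + 1.
Proof.
have [n] := ubnP #|U|; elim: n U => // n IH U; rewrite ltnS => leUn U2.
have /card_gt0P[x xU] : 0 < #|U| by lia.
have /card_gt0P[y] : 0 < #|U :\ x| by have := cardsD1 x U; rewrite xU; lia.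
rewrite in_setD1 => /andP[yx yU].
pose U' := U :\ x :\ y.
have cU : #|U| = #|U'| + 2.
  by rewrite (cardsD1 x U) (cardsD1 y (U :\ x)) in_setD1 yx yU xU -/U'; lia.
have inU z : z \in U -> [|| z == x, z == y | z \in U'].
  by rewrite !in_setD1 => ->; case: (z == x); case: (z == y).
have xyK : [set x; y] \in complete_graph U.
  by apply/complete_graphP; rewrite subUset !sub1set xU yU cards2 eq_sym yx.
have step C : C \subset complete_graph U ->
    (forall z, z \in U' -> exists2 t, t != z & [set z; t] \in C) ->
    edge_cover U (complete_graph U) ([set x; y] |: C).
  move=> sCK covC; apply/edge_coverP; split; first by rewrite subUset sub1set xyK.
  move=> z /inU/or3P[/eqP->|/eqP->|/covC[t tz ztC]].
  - by exists y; rewrite // setU11.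
  - by exists x; rewrite 1?eq_sym // setUC setU11.
  - by exists t; rewrite // inE ztC orbT.
have [U'2|U'2] := leqP 2 #|U'|.
  have [|C /edge_coverP[sCK covC] cC] := IH U' _ U'2; first by lia.
  exists ([set x; y] |: C).
    apply: step => //; apply: subset_trans sCK _.
    apply/subsetP=> e /complete_graphP[eU' e2]; apply/complete_graphP; split=> //.
    by apply: subset_trans eU' _; rewrite !subDset !subsetU ?subxx ?orbT.
  apply: (@leq_trans (2 * (1 + #|C|))); last by lia.
  by rewrite leq_mul2l /= cardsU1 leq_add ?leq_b1.
exists ([set x; y] |: [set [set z; x] | z in U']).
  apply: step.
    apply/subsetP=> e /imsetP[z]; rewrite !in_setD1 => /and3P[_ zx zU] ->.
    by apply/complete_graphP; rewrite subUset !sub1set zU xU cards2 zx.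
  move=> z zU'; exists x; last exact: imset_f.
  by move: zU'; rewrite !in_setD1 => /and3P[_ zx _]; rewrite eq_sym; exact: zx.
apply: (@leq_trans (2 * (1 + #|U'|))); last by lia.
by rewrite leq_mul2l /= cardsU1 leq_add ?leq_b1 ?leq_imset_card.
Qed.

(** Otherwise both ends of the edge would still be covered after its removal.  The
    vertex [c] found here is adjacent in the complement of [C] to all of [U] except
    [x] and [y]: it is the centre of a star with [#|U| - 2] leaves. *)
Lemma min_edge_cover_leaf U C x y :
    min_edge_cover U (complete_graph U) C -> x != y -> [set x; y] \in C ->
  exists2 c, c \in [set x; y] &
    forall z, z \in U -> z \notin [set x; y] -> [set c; z] \notin C.
Proof.
move=> /andP[covC /forallP minC] xy xyC.
have noteq c z : z \notin [set x; y] -> [set c; z] != [set x; y].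
  by apply: contraNneq => <-; rewrite !inE eqxx orbT.
have [/exists_inP[c cxy /forall_inP hc]|] := boolP [exists c in [set x; y],
    [forall z in U, (z \notin [set x; y]) ==> ([set c; z] \notin C)]].
  by exists c => // z zU; apply/implyP/hc.
rewrite negb_exists_in => /forall_inP hn.
have {hn}hn c : c \in [set x; y] ->
    exists2 z, z \notin [set x; y] & [set c; z] \in C.
  move=> /hn; rewrite negb_forall_in => /exists_inP[z zU].
  by rewrite negb_imply negbK => /andP[]; exists z.
have := minC (C :\ [set x; y]); rewrite leqNgt [X in _ < X](cardsD1 [set x; y]).
rewrite xyC add1n ltnSn implybF => /negP[] {minC}.
have [sCK cov] := edge_coverP _ _ covC.
apply/edge_coverP; split; first by rewrite subDset subsetU // sCK orbT.
move=> t tU; have [txy|txy] := boolP (t \in [set x; y]).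
  have [z zxy tzC] := hn t txy; exists z; first by apply: contraNneq zxy => ->.
  by rewrite in_setD1 noteq.
have [z zt tzC] := cov t tU; exists z => //; rewrite in_setD1 tzC andbT.
by rewrite setUC noteq.
Qed.

End Covers.

(** * The extension of a graph to a 3-uniform hypergraph *)

Section Extension.
Variable V : finType.
Implicit Types (U h : {set V}) (C G : {set {set V}}).

Lemma extensionP U G h :
  reflect ((exists v e, [/\ v \notin U, e \in G & h = v |: e]) \/
           (h \subset U /\ #|h| = 3))
    (h \in extension U G).
Proof.
rewrite inE; apply: (iffP orP) => -[].
- by move=> /imset2P[v e]; rewrite inE => vU eG ->; left; exists v, e.
- by rewrite inE => /andP[hU /eqP h3]; right.
- by move=> [v [e [vU eG ->]]]; left; apply: imset2_f; rewrite ?inE.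
- by move=> [hU h3]; right; rewrite inE hU h3 eqxx.
Qed.

Lemma card_extension U G : G \subset complete_graph U ->
  #|extension U G| = #|G| * (#|V| - #|U|) + 'C(#|U|, 3).
Proof.
move=> sGK.
have GU e : e \in G -> e \subset U by move=> /(subsetP sGK)/complete_graphP[].
have capU v e : v \notin U -> e \in G -> (v |: e) :&: U = e.
  move=> vU eG; rewrite setIUl (setIidPl (GU e eG)).
  by rewrite (_ : [set v] :&: U = set0) ?set0U //; apply/disjoint_setI0; rewrite disjoints1.
rewrite /extension cardsU cards_draws curry_imset2X card_in_imset; last first.
  move=> [v1 e1] [v2 e2] /setXP[/= v1U e1G] /setXP[/= v2U e2G] /= eq12.
  rewrite !inE in v1U v2U.
  have e12 : e1 = e2 by rewrite -(capU v1 e1) // eq12 capU.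
  have : v1 \in v2 |: e2 by rewrite -eq12 setU11.
  rewrite in_setU1 => /orP[/eqP->|]; first by rewrite e12.
  by move=> /(subsetP (GU _ e2G)); rewrite (negbTE v1U).
rewrite cardsX [X in _ - X](_ : _ = 0).
  have -> : #|V| - #|U| = #|~: U| by have := cardsC U; lia.
  by rewrite subn0 mulnC.
apply: eq_card0 => h; rewrite in_setI; apply/negP => /andP[/imsetP[[v e]]].
move=> /setXP[/= vU eG] ->; rewrite !inE in vU * => /andP[/subsetP/(_ v)].
by rewrite !inE eqxx (negbTE vU) => /(_ isT).
Qed.

Lemma extension_uniform U G :
  G \subset complete_graph U -> uniform 3 (extension U G).
Proof.
move=> sGK; apply/forall_inP=> h /extensionP[[v [e [vU eG ->]]]|[_ ->]] //.
have /complete_graphP[eU e2] := subsetP sGK e eG.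
by rewrite cardsU1 e2 (contra (subsetP eU v) vU).
Qed.

(** Each of the [s + 1] disjoint trace edges [p i] meets [U], because a hyperedge of
    the extension has at least two vertices in [U] and loses only one of its
    vertices.  So [U] has one vertex [x] more than needed.  Covering [x] by an edge
    [{x, y}] of [C], the trace edge through [y] comes from a hyperedge that meets
    [U] in [{x, y}] exactly, although this is not an edge of the graph. *)
Lemma extension_trace_free s U C :
    0 < s -> #|U| = s + 2 -> edge_cover U (complete_graph U) C ->
  ~~ contains_trace (matching s.+1) (extension U (complete_graph U :\: C)).
Proof.
move=> s0 cU /edge_coverP[sCK covC]; set G := _ :\: _.
have sGK : G \subset complete_graph U by rewrite subsetDl.
apply/negP=> /existsP[S /andP[/eqP cS]] /existsP[f].
case/and3P=> /injectiveP injf /forallP fS /forall_inP fT.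
pose p i := [set f (i, false); f (i, true)].
have card_p i : #|p i| = 2 by rewrite cards2 (inj_eq injf) xpair_eqE eqxx.
have pP i : exists2 h, h \in extension U G & p i = h :&: S.
  have /fT/imsetP[h hH e] : [set (i, false); (i, true)] \in matching s.+1.
    exact: imset_f.
  by exists h; rewrite // -e imsetU1 imset_set1.
have SE : S = [set f q | q : _].
  apply/esym/eqP; rewrite eqEcard card_imset // cS leqnn andbT.
  by apply/subsetP=> _ /imsetP[q _ ->].
have inp i b : f (i, b) \in p i by case: b; rewrite !inE eqxx ?orbT.
have pS i : p i \subset S by have [h _ ->] := pP i; apply: subsetIr.
have p_eq i j z : z \in p i -> z \in p j -> i = j.
  by move=> /set2P[]-> /set2P[]/injf[].
have capU h : h \in extension U G -> 2 <= #|h :&: U|.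
  move=> /extensionP[[v [e [vU eG ->]]]|[hU h3]]; last by rewrite (setIidPl hU) h3.
  have /complete_graphP[eU <-] := subsetP sGK e eG.
  by apply: subset_leq_card; rewrite subsetI subsetUr.
(* if [U] were contained in [S], all [p i] would be contained in [U] *)
have [x xU xS] : exists2 x, x \in U & x \notin S.
  apply/subsetPn/negP => sUS.
  have pU i : p i \subset U.
    have [h hH pE] := pP i.
    have /eqP -> : p i == h :&: U; last exact: subsetIr.
    by rewrite eq_sym eqEcard card_p capU // pE setIS.
  have : S \subset U.
    rewrite SE; apply/subsetP=> _ /imsetP[[i b] _ ->].
    by apply: subsetP (pU i) _ (inp i b).
  move=> /subset_leq_card; rewrite cS cU card_prod card_ord card_bool; lia.
pose u i := if f (i, false) \in U then f (i, false) else f (i, true).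
have up i : u i \in p i by rewrite /u; case: ifP.
have uU i : u i \in U.
  rewrite /u; case: ifPn => // f0.
  have [h hH pE] := pP i.
  have h3 : #|h| = 3 by apply/eqP/(forall_inP (extension_uniform sGK)).
  have : 0 < #|(h :&: S) :&: (h :&: U)|.
    have := cardsUI (h :&: S) (h :&: U); rewrite -pE card_p.
    have := capU h hH.
    have : #|p i :|: h :&: U| <= #|h|.
      by apply: subset_leq_card; rewrite pE subUset !subsetIl.
    lia.
  move=> /card_gt0P[z]; rewrite -pE !in_setI => /and3P[/set2P[]-> _ //].
  by rewrite (negbTE f0).
have injU : injective u.
  by move=> i j uij; apply: (p_eq i j (u i)); rewrite // uij.
have uE : [set u i | i : _] = U :\ x.
  apply/eqP; rewrite eqEcard card_imset // card_ord; apply/andP; split.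
    apply/subsetP=> _ /imsetP[i _ ->]; rewrite in_setD1 uU andbT.
    by apply: contraNneq xS => <-; apply: (subsetP (pS i)).
  by have := cardsD1 x U; rewrite xU; lia.
have [y yx xyC] := covC x xU.
have /imsetP[j _ yE] : y \in [set u i | i : _].
  rewrite uE in_setD1 yx; have /complete_graphP[/subsetP-> //] := subsetP sCK _ xyC.
  by rewrite !inE eqxx orbT.
have [h hH pE] := pP j.
have hxy : h :&: U = [set x; y].
  apply/eqP; rewrite eqEcard cards2 eq_sym yx capU // andbT.
  apply/subsetP=> z /setIP[zh zU]; have [->|zx] := eqVneq z x; first by rewrite !inE eqxx.
  have /imsetP[k _ zE] : z \in [set u i | i : _] by rewrite uE in_setD1 zx.
  have zp : z \in p j.
    by rewrite pE in_setI zh (subsetP (pS k)) // zE.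
  have kj : k = j by apply: (p_eq k j z); rewrite // zE.
  by rewrite zE kj -yE !inE eqxx orbT.
case/extensionP: hH => [[v [e [vU eG hE]]]|[hU h3]]; last first.
  by move: h3; rewrite -(setIidPl hU) hxy cards2 eq_sym yx.
have /complete_graphP[eU e2] := subsetP sGK e eG.
have : e = [set x; y].
  apply/eqP; rewrite eqEcard e2 cards2 eq_sym yx andbT -hxy.
  by rewrite subsetI eU hE subsetUr.
by move=> eE; move: eG; rewrite in_setD eE xyC.
Qed.

End Extension.

(** * Hypergraphs without a large trace of a matching *)

Lemma union_bound (I T : finType) (R : I -> T -> bool) (F : {set I})
    (P : {set T}) m :
    (forall h, h \in P -> exists2 i, i \in F & R i h) ->
    (forall i, i \in F -> #|[set h in P | R i h]| <= m) ->
  #|P| <= #|F| * m.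
Proof.
move=> PF Fm; apply: (@leq_trans (\sum_(h in P) \sum_(i in F) R i h)).
  rewrite -sum1_card; apply: leq_sum => h /PF[i iF Rih].
  by rewrite (bigD1 i) //= Rih.
rewrite exchange_big -sum_nat_const; apply: leq_sum => i /Fm; apply: leq_trans.
rewrite -sum1_card big_mkcond [leqRHS]big_mkcond; apply: leq_sum => h _.
by rewrite inE; case: (h \in P); case: (R i h).
Qed.

Lemma card3_set (V : finType) (h : {set V}) v : #|h| = 3 -> v \in h ->
  exists a b, h = [set v; a; b] /\ uniq [:: v; a; b].
Proof.
move=> h3 vh; have /eqP/cards2P[a [b [ab hE]]] : #|h :\ v| = 2.
  by have := cardsD1 v h; rewrite vh h3 add1n => /succn_inj <-.
exists a, b; split; first by rewrite -setUA -hE setD1K.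
have : v \notin h :\ v by rewrite setD11.
by rewrite hE /= !inE ab andbT => ->.
Qed.

Section UniformHypergraph.
Variables (V : finType) (H : {set {set V}}).
Hypothesis (H3 : uniform 3 H).

Lemma uniform3 h : h \in H -> #|h| = 3.
Proof. by move=> hH; apply/eqP/(forall_inP H3). Qed.

Lemma codegree_le (P : {set {set V}}) x y : P \subset H -> x != y ->
  #|[set h in [set h in P | x \in h] | y \in h]| <= #|completions H [set x; y]|.
Proof.
move=> sPH xy.
apply: leq_trans (leq_imset_card (fun v => v |: [set x; y]) _).
apply: subset_leq_card; apply/subsetP=> h; rewrite !inE => /andP[/andP[hP xh] yh].
have hH := subsetP sPH h hP.
have [a [b [hE _]]] := card3_set (uniform3 hH) xh.
have [z zE] : exists z, h = z |: [set x; y].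
  move: yh; rewrite hE !inE eq_sym (negbTE xy) /= => /orP[]/eqP ->.
    by exists b; rewrite setUC.
  by exists a; rewrite setUA [[set a] :|: _]setUC.
by apply/imsetP; exists z; rewrite ?inE -?zE.
Qed.

(** The vertices of a longest trace matching made of disjoint hyperedges of [P]
    form the set [F]. *)
Lemma greedy_disjoint (P : {set {set V}}) k : P \subset H ->
  (exists2 l, trace_matching H l & size l = k) \/
  (exists2 F : {set V}, #|F| <= 3 * k.-1 &
     forall h, h \in P -> exists2 x, x \in F & x \in h).
Proof.
move=> sPH; elim: k => [|k [[l tl szl]|[F cF FP]]]; first by left; exists [::].
  pose F := [set x in spine l ++ apexes l].
  have [hF|] := boolP [forall h in P, [exists x in F, x \in h]].
    right; exists F => [|h hP]; last by apply/exists_inP/(forall_inP hF).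
    rewrite cardsE; apply: leq_trans (card_size _) _.
    by rewrite size_cat size_spine size_map szl /=; clear; lia.
  rewrite negb_forall_in => /exists_inP[h hP]; rewrite negb_exists_in.
  move=> /forall_inP hF; left; have hH := subsetP sPH h hP.
  have /card_gt0P[a ah] : 0 < #|h| by rewrite uniform3.
  have [b [w [hE abw]]] := card3_set (uniform3 hH) ah.
  have hl x : x \in h -> x \notin spine l ++ apexes l.
    by apply: contraL => xl; apply: hF; rewrite inE.
  exists ((a, b, w) :: l); last by rewrite /= szl.
  have [bh wh] : b \in h /\ w \in h by rewrite hE !inE !eqxx !orbT.
  rewrite trace_matching_cons tl -hE hH abw !hl //=.
  by have := hl w wh; rewrite mem_cat negb_or => /andP[].
by right; exists F => //; apply: leq_trans cF _; clear; lia.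
Qed.

(** The same with [x] as common apex: the pairs completing [x] to a hyperedge of
    [P] are chosen disjoint as long as possible. *)
Lemma greedy_link (P : {set {set V}}) x k : P \subset H ->
  (exists2 l, trace_matching H l & size l = k) \/
  (exists2 F : {set V}, (#|F| <= 2 * k.-1) && (x \notin F) &
     forall h, h \in [set h in P | x \in h] -> exists2 y, y \in F & y \in h).
Proof.
move=> sPH.
suff : (exists2 l, trace_matching H l && all (pred1 x) (apexes l) &
          size l = k /\ x \notin spine l) \/
  (exists2 F : {set V}, (#|F| <= 2 * k.-1) && (x \notin F) &
     forall h, h \in [set h in P | x \in h] -> exists2 y, y \in F & y \in h).
  by case=> [[l /andP[tl _] [szl _]]|]; [left; exists l | right].
elim: k => [|k [[l /andP[tl al] [szl xl]]|[F /andP[cF xF] FP]]].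
- by left; exists [::].
- pose F := [set x in spine l].
  have [hF|] := boolP [forall h in [set h in P | x \in h], [exists y in F, y \in h]].
    right; exists F => [|h hP]; last by apply/exists_inP/(forall_inP hF).
    rewrite cardsE inE xl andbT; apply: leq_trans (card_size _) _.
    by rewrite size_spine szl mul2n.
  rewrite negb_forall_in => /exists_inP[h]; rewrite inE negb_exists_in.
  move=> /andP[hP xh] /forall_inP hF; left; have hH := subsetP sPH h hP.
  have [a [b [hE /= abx]]] := card3_set (uniform3 hH) xh.
  have hl y : y \in h -> y \notin spine l.
    by apply: contraL => yl; apply: hF; rewrite inE.
  have apx y : y != x -> y \notin apexes l.
    by apply: contra => /(allP al).
  move: abx; rewrite !inE negb_or andbT => /andP[/andP[xa xb] ab].
  have [ah bh] : a \in h /\ b \in h by rewrite hE !inE !eqxx !orbT.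
  exists ((a, b, x) :: l); last first.
    by rewrite /= szl spine_cons !inE !negb_or xa xb xl.
  rewrite /= eqxx al andbT trace_matching_cons tl !mem_cat !negb_or.
  have -> : [set a; b; x] = h by rewrite hE -[RHS]setUA setUC.
  rewrite hH /= !inE !negb_or ab !(eq_sym _ x) xa xb xl.
  by rewrite !hl ?apx // 1?eq_sym.
by right; exists F => //; rewrite xF andbT; apply: leq_trans cF _; clear; lia.
Qed.

Definition light_edges K : {set {set V}} :=
  [set h in H | ~~ [exists e in heavy_pairs H K, e \subset h]].

Lemma card_heavy_light K :
  #|H| <= #|heavy_pairs H K| * #|V| + #|light_edges K|.
Proof.
pose R (e h : {set V}) := e \subset h.
have heavy : #|H :\: light_edges K| <= #|heavy_pairs H K| * #|V|.
  apply: (@union_bound _ _ R) => [h|e].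
    rewrite in_setD /light_edges inE => /andP[+ hH].
    by rewrite hH negbK => /exists_inP.
  rewrite inE => /andP[/cards2P[x [y [xy ->]]] _].
  apply: leq_trans (max_card (completions H [set x; y])).
  apply: leq_trans (codegree_le (subxx H) xy).
  apply: subset_leq_card; apply/subsetP=> h; rewrite inE /R subUset !sub1set.
  by rewrite !inE => /andP[/andP[_ ->] /andP[-> ->]].
rewrite -(cardsID (light_edges K) H) addnC leq_add //.
by apply/subset_leq_card/subsetIr.
Qed.

Section TraceFree.
Variable s : nat.
Hypotheses (s0 : 0 < s) (noT : ~~ contains_trace (matching s.+1) H).
Local Notation K := (3 * s.+1).
Local Notation G := (heavy_pairs H K).

Lemma trace_matching_size l : trace_matching H l -> size l <> s.+1.
Proof.
by move=> tl szl; move: noT; rewrite (trace_matching_contains tl szl).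
Qed.

(** The light hyperedges are hit by [3 s] vertices, those through a given vertex
    [x] are hit by [2 s] further vertices [y], and since [{x, y}] is not heavy or is
    contained in no light hyperedge, at most [K] of them pass through both. *)
Lemma card_light_edges : #|light_edges K| <= 3 * s * (2 * s * K).
Proof.
pose R x (h : {set V}) := x \in h.
have sLH : light_edges K \subset H by apply/subsetP=> h; rewrite inE => /andP[].
have [[l tl /(trace_matching_size tl)//]|[F cF FP]] :=
  greedy_disjoint s.+1 sLH.
apply: leq_trans (leq_mul cF (leqnn _)).
apply: (@union_bound _ _ R) => // x _.
have [[l tl /(trace_matching_size tl)//]|[F' /andP[cF' xF'] FP']] :=
  greedy_link x s.+1 sLH.
apply: leq_trans (leq_mul cF' (leqnn _)).
apply: (@union_bound _ _ R) => // y yF'.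
have xy : x != y by apply: contraNneq xF' => ->.
set P := [set h in _ | R y h].
have [->|/set0Pn[h]] := eqVneq P set0; first by rewrite cards0.
rewrite !inE /R => /andP[/andP[/andP[hH lh] xh] yh].
apply: leq_trans (codegree_le sLH xy) _; apply: ltnW; rewrite ltnNge.
apply: contra lh => Kxy; apply/exists_inP; exists [set x; y].
  by rewrite inE cards2 xy.
by rewrite subUset !sub1set xh yh.
Qed.

(** A trace matching [l] together with stars of heavy pairs away from it gives a
    trace matching with one edge per triple of [l] and one per leaf, which cannot
    reach [s + 1] edges. *)
Lemma star_matching_bound l (D L : {set V}) :
    trace_matching H l -> [disjoint D & L] ->
    (forall c, c \in D -> c \notin spine l) ->
    (forall x, x \in L -> x \notin spine l ++ apexes l) ->
    (forall x, x \in L -> exists2 c, c \in D & [set c; x] \in G) ->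
    size l <= s -> size l + #|L| <= s.
Proof.
move=> tl DL Dl Ll LD szl; rewrite leqNgt; apply/negP => big.
pose ctr x := odflt x [pick c in D | [set c; x] \in G].
have ctrP x : x \in L -> ctr x \in D /\ [set x; ctr x] \in G.
  move=> /LD[c cD cx]; rewrite /ctr; case: pickP => [c' /andP[]|/(_ c)].
    by rewrite setUC.
  by rewrite cD cx.
(* [trace_matching_size] excludes the length [s + 1] only, so excess leaves are
   dropped *)
pose L0 := take (s.+1 - size l) (enum L).
have sL0 : size L0 = s.+1 - size l.
  by rewrite size_take_min -cardE; apply/minn_idPl; rewrite leq_subLR.
have L0L x : x \in L0 -> x \in L by move/mem_take; rewrite mem_enum.
set D0 := [seq (x, ctr x) | x <- L0].
have fstE : unzip1 D0 = L0 by rewrite /unzip1 -map_comp map_id.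
have UD0 : uniq (unzip1 D0) by rewrite fstE take_uniq // enum_uniq.
have [||l' tl'] := star_extension (K := K) tl UD0.
- move=> _ /mapP[x /L0L xL ->]; have [cD cG] := ctrP x xL.
  rewrite fstE; split; rewrite ?Ll ?Dl //.
  by apply: contraL cD => /L0L cL; rewrite (disjointFl DL cL).
- by rewrite size_map sL0 subnKC // leqW.
by rewrite size_map sL0 subnKC ?leqW // => /(trace_matching_size tl').
Qed.

Lemma heavy_star_bound : star_bound (fun x y => [set x; y] \in G) s.
Proof.
move=> D L DL LD; rewrite -[#|L|]add0n.
exact: (@star_matching_bound [::] D L).
Qed.

(** When [c] misses only the other end of [{x, y}], its star in the heavy graph has
    [s] leaves, and one more trace edge [{a, b}] is too many. *)
Lemma no_edge_beside_full_star (U : {set V}) (C : {set {set V}}) x y c a b w :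
    #|U| = s + 2 -> G = complete_graph U :\: C -> x != y -> x \in U -> y \in U ->
    c \in [set x; y] ->
    (forall z, z \in U -> z \notin [set x; y] -> [set c; z] \notin C) ->
    [set a; b; w] \in H -> uniq [:: a; b; w] ->
    a \notin c |: (U :\: [set x; y]) -> b \notin c |: (U :\: [set x; y]) ->
    w \notin U :\: [set x; y] -> False.
Proof.
move=> cU GE xy xU yU cxy cC habw abw; set L := U :\: _.
have cL : #|L| = s.
  rewrite cardsD (setIidPr _) ?cards2 ?xy ?cU ?addnK //.
  by rewrite subUset !sub1set xU.
rewrite !in_setU1 !negb_or => /andP[ac aL] /andP[bc bL] wL.
have := @star_matching_bound [:: (a, b, w)] [set c] L.
rewrite cL /= ltnn => bound; suff: false by [].
have cU' : c \in U by move: cxy => /set2P[]->.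
apply: bound s0; first by rewrite trace_matching_cons habw abw.
- by rewrite disjoints1 in_setD cxy.
- by move=> _ /set1P->; rewrite !inE negb_or !(eq_sym c) ac bc.
- move=> z zL; rewrite /= !inE !negb_or.
  by apply/and3P; split; apply: contraTneq zL => ->.
move=> z; rewrite in_setD => /andP[zxy zU]; exists c; first exact: set11.
rewrite GE in_setD cC //; apply/complete_graphP; rewrite subUset !sub1set cU' zU.
by rewrite cards2; case: eqP => // cz; rewrite -cz cxy in zxy.
Qed.

(** A hyperedge outside the extension supplies the extra trace edge in
    [no_edge_beside_full_star].  Depending on whether it meets [U] in a pair of
    [C], in one vertex or not at all, the edge [{x, y}] of [C] is that pair, a pair
    through that vertex, or arbitrary. *)
Lemma confinement (U : {set V}) (C : {set {set V}}) :
    #|U| = s + 2 -> min_edge_cover U (complete_graph U) C ->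
    G = complete_graph U :\: C -> H \subset extension U (complete_graph U :\: C).
Proof.
move=> cU minC GE; apply/subsetP=> h hH; apply/extensionP.
have h3 := uniform3 hH.
have [hU|/subsetPn[v vh vU]] := boolP (h \subset U); [by right | left].
have [sCK covC] := edge_coverP _ _ (proj1 (andP minC)).
have leaf x : x \in U -> exists y c, [/\ x != y, y \in U, c \in [set x; y] &
    forall z, z \in U -> z \notin [set x; y] -> [set c; z] \notin C].
  move=> xU; have [y yx xyC] := covC x xU; rewrite eq_sym in yx.
  have /complete_graphP[] := subsetP sCK _ xyC; rewrite subUset !sub1set.
  move=> /andP[_ yU] _; have [c cxy hc] := min_edge_cover_leaf minC yx xyC.
  by exists y, c.
have [a [b [hE vab]]] := card3_set h3 vh.
wlog aU : a b hE vab / (b \in U) ==> (a \in U).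
  move=> th; have [aU|aU] := boolP (a \in U).
    by apply: (th a b); rewrite ?aU ?implybT.
  apply: (th b a); last by rewrite (negbTE aU).
    by rewrite hE setUAC.
  by move: vab; rewrite /= !inE !negb_or (eq_sym b a) [(v != a) && _]andbC.
move: (vab); rewrite /= !inE negb_or andbT => /andP[/andP[va vb] ab].
have out z c L : z \notin U -> c \in U -> z \notin c |: (U :\: L).
  move=> zU cU'; rewrite !inE negb_or (negbTE zU) andbF andbT.
  by apply: contraNneq zU => ->.
have ends z c x y : z \in [set x; y] -> z != c -> z \notin c |: (U :\: [set x; y]).
  by move=> zxy zc; rewrite in_setU1 in_setD negb_or zc zxy.
have outD z L : z \notin U -> z \notin U :\: L.
  by move=> zU; rewrite in_setD (negbTE zU) andbF.
have endsD z x y : z \in [set x; y] -> z \notin U :\: [set x; y].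
  by move=> zxy; rewrite in_setD zxy.
have uniq3 x y z : x != y -> x != z -> y != z -> uniq [:: x; y; z].
  by move=> xy xz yz; rewrite /= !inE negb_or xy xz yz.
have avb : [set a; v; b] = h by rewrite hE [[set a] :|: _]setUC.
have bva : [set b; v; a] = h by rewrite hE -setUA setUC.
have vba : [set v; b; a] = h by rewrite hE setUAC.
have beside := no_edge_beside_full_star cU GE.
(* a trace edge may use the ends of [{x, y}] but no other vertex of [U], and not
   the centre [c], which can only be an apex *)
have [a_in|a_out] := boolP (a \in U); last first.
  have b_out : b \notin U by apply: contra a_out => bU; rewrite bU in aU.
  have /card_gt0P[x xU] : 0 < #|U| by rewrite cU addn2.
  have [y [c [xy yU cxy hc]]] := leaf x xU.
  have cU' : c \in U by move: cxy => /set2P[]->.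
  rewrite hE in hH.
  by have [] := beside _ _ _ _ _ _ xy xU yU cxy hc hH vab; auto.
have [b_in|b_out] := boolP (b \in U); last first.
  have [y [c [ay yU cay hc]]] := leaf a a_in.
  case/set2P: (cay) => cE.
    rewrite -vba in hH.
    by have [] := beside _ _ _ _ _ _ ay a_in yU cay hc hH; rewrite ?cE; auto;
      [rewrite uniq3 // eq_sym | apply: endsD; rewrite !inE eqxx].
  rewrite -avb in hH.
  by have [] := beside _ _ _ _ _ _ ay a_in yU cay hc hH; rewrite ?cE; auto;
    [rewrite uniq3 // eq_sym | apply: ends; rewrite // !inE eqxx].
exists v, [set a; b]; split; rewrite ?hE ?setUA //.
have abK : [set a; b] \in complete_graph U.
  by apply/complete_graphP; rewrite subUset !sub1set a_in b_in cards2 ab.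
rewrite in_setD abK andbT; apply/negP => abC.
have [c cab hc] := min_edge_cover_leaf minC ab abC.
case/set2P: (cab) => cE.
  rewrite -bva in hH.
  by have [] := beside _ _ _ _ _ _ ab a_in b_in cab hc hH; rewrite ?cE; auto;
    [rewrite uniq3 // eq_sym | apply: ends; rewrite 1?eq_sym // !inE eqxx orbT
    | apply: endsD; rewrite !inE eqxx].
rewrite -avb in hH.
by have [] := beside _ _ _ _ _ _ ab a_in b_in cab hc hH; rewrite ?cE; auto;
  [rewrite uniq3 // eq_sym | apply: ends; rewrite // !inE eqxx
  | apply: endsD; rewrite !inE eqxx orbT].
Qed.

End TraceFree.
End UniformHypergraph.

(** * Degree sums *)

Section PairGraph.
Variables (V : finType) (G : {set {set V}}).
Hypothesis G2 : {in G, forall e : {set V}, #|e| = 2}.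

Definition adjacent : rel V := fun x y => [set x; y] \in G.

Lemma adjacent_sym : symmetric adjacent.
Proof. by move=> x y; rewrite /adjacent setUC. Qed.

Lemma adjacent_irr : irreflexive adjacent.
Proof. by move=> x; apply/negP => /G2; rewrite setUid cards1. Qed.

Lemma handshake : \sum_x degree adjacent x = #|G| * 2.
Proof.
transitivity (\sum_x \sum_(e in G) (x \in e : nat)).
  apply: eq_bigr => x _; rewrite /degree.
  have injx : {in neighbours adjacent x &, injective (fun y => [set x; y])}.
    move=> y z; rewrite !in_neighbours => xy _ /= /setP/(_ y).
    rewrite !inE eqxx orbT => /esym/orP[/eqP yx|/eqP//].
    by rewrite yx adjacent_irr in xy.
  rewrite -(card_in_imset injx) -sum1_card big_mkcond [RHS]big_mkcond.
  apply: eq_bigr => e _; have [eG|eG] := boolP (e \in G).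
    have [xe|xe] := boolP (x \in e).
      have /eqP/cards2P[a [b [ab eE]]] := G2 eG.
      rewrite ifT //; apply/imsetP; move: xe eG; rewrite eE => /set2P[]-> abG.
        by exists b; rewrite ?in_neighbours.
      by exists a; rewrite 1?setUC // in_neighbours adjacent_sym.
    rewrite ifF //; apply/imsetP => -[y _ eE].
    by rewrite eE !inE eqxx in xe.
  rewrite ifF //; apply/imsetP => -[y]; rewrite in_neighbours => xy eE.
  by rewrite eE in eG; rewrite /adjacent (negbTE eG) in xy.
rewrite exchange_big -sum_nat_const; apply: eq_bigr => e /G2 <-.
by rewrite -sum1_card [RHS]big_mkcond; apply: eq_bigr => x _; case: (x \in e).
Qed.

End PairGraph.

(** * The extremal hypergraphs *)

Lemma bin2_le_extremal s c : s + 2 <= 2 * c ->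
  'C(s + 2, 2) <= s * (s + 2) %/ 2 + c.
Proof.
have : (s + 2) * (s + 2).-1 = s * (s + 2) + (s + 2) by rewrite addn2 /=; nia.
by rewrite bin2 -divn2; set p := _ * _.-1; set q := s * _; clearbody p q; lia.
Qed.

(** The two sides agree for the largest [c] only because [s (s + 2)] is odd when
    [s] is, hence the rewriting of [s (s + 2)] as [2 r + s]. *)
Lemma extremal_le_bin2 s c : 2 * c <= s + 2 + 1 ->
  s * (s + 2) %/ 2 <= 'C(s + 2, 2) - c.
Proof.
have [r rE] : exists r, s * (s + 2) = 2 * r + s.
  exists (s.+1 * s)./2; have := odd_double_half (s.+1 * s).
  rewrite oddM oddS andNb add0n -mul2n => ->; nia.
have : (s + 2) * (s + 2).-1 = s * (s + 2) + (s + 2) by rewrite addn2 /=; nia.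
rewrite bin2 -divn2 rE; set p := _ * _.-1; clearbody p; clear; lia.
Qed.

Definition extremal_size s n := (s * (s + 2)) %/ 2 * (n - s - 2) + 'C(s + 2, 3).

(** Beyond this order, one heavy pair less than the maximum, which costs about
    [n] hyperedges, cannot be made up for by the light hyperedges, whose number is
    bounded by the second summand. *)
Definition large_order s : nat :=
  (s * (s + 2)) %/ 2 * (s + 2) + 3 * s * (2 * s * (3 * s.+1)) + s + 3.

Lemma leq_large_order s : s + 2 <= large_order s.
Proof. by rewrite /large_order -addnA; apply: leq_trans (leq_addl _ _); lia. Qed.

(** The number of hyperedges is at most [n] times the number of heavy pairs plus a
    constant, so there are as many heavy pairs as Vizing's bound permits.  All degrees of the heavy
    graph are then at most [s], so each vertex of [U] is missing at least one
    edge: the missing edges form a cover, and their number shows that it is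
    minimum. *)
Lemma heavy_graph_structure (V : finType) (H : {set {set V}}) s :
    0 < s -> large_order s <= #|V| -> uniform 3 H ->
    ~~ contains_trace (matching s.+1) H -> extremal_size s #|V| <= #|H| ->
  exists (U : {set V}) (C : {set {set V}}),
    [/\ #|U| = s + 2, min_edge_cover U (complete_graph U) C,
        heavy_pairs H (3 * s.+1) = complete_graph U :\: C
      & #|complete_graph U :\: C| = s * (s + 2) %/ 2].
Proof.
move=> s0 nV H3 noT leH; set G := heavy_pairs H _.
have G2 : {in G, forall e : {set V}, #|e| = 2} by move=> e; rewrite inE => /andP[/eqP].
have gC := adjacent_sym G; have gI := adjacent_irr G2.
have gs : star_bound (adjacent G) s := heavy_star_bound noT.
have hG := handshake G2; have le_deg := vizing gC gI gs.
have le_heavy := card_heavy_light H3 (3 * s.+1).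
have le_light := card_light_edges H3 noT.
set f := s * (s + 2) %/ 2.
have f0 : 0 < f by rewrite divn_gt0 //; case: (s) s0 => // t _; clear; nia.
have geG : f <= #|G|.
  rewrite leqNgt; apply/negP => ltGf.
  move: leH nV le_heavy le_light; rewrite -/G /extremal_size /large_order -/f.
  set c := 3 * s * _; set n := #|V|; set l := #|light_edges _ _|.
  set g := #|G| in ltGf *; set m := #|H|; set b := 'C(_, _).
  have : g * n + n <= f * n by rewrite -mulSnr leq_mul2r ltGf orbT.
  have : f * (n - s - 2) + f * (s + 2) >= f * n.
    by rewrite -mulnDr leq_mul2l; apply/orP; right; clear; lia.
  clearbody f c n l g m b; clear; lia.
have leG : #|G| = f.
  apply/eqP; rewrite eqn_leq geG andbT /f leq_divRL // -hG; exact: le_deg.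
have Vs : s + 2 <= #|V| := leq_trans (leq_large_order s) nV.
have [|U [cU gU degU]] := vizing_extremal s0 Vs gC gI gs.
  by rewrite hG leG.
have GK : G \subset complete_graph U.
  apply/subsetP=> e eG; have /eqP/cards2P[x [y [_ eE]]] := G2 e eG.
  apply/complete_graphP; split; last exact: G2.
  have xy : adjacent G x y by rewrite /adjacent -eE.
  by rewrite eE subUset !sub1set (gU x y) //= (gU y x) // gC.
exists U, (complete_graph U :\: G).
have KCG : complete_graph U :\: (complete_graph U :\: G) = G.
  by rewrite setDDr setDv set0U; apply/setIidPr.
rewrite KCG leG; split=> //.
have cover : edge_cover U (complete_graph U) (complete_graph U :\: G).
  apply/edge_coverP; split=> [|x xU]; first exact: subsetDl.
  have /subsetPn[y] : ~~ (U :\ x \subset neighbours (adjacent G) x).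
    apply: contraL (degU x) => /subset_leq_card le_x; rewrite -ltnNge.
    apply: leq_trans le_x.
    by have := cardsD1 x U; rewrite xU cU addn2 add1n => /succn_inj <-.
  rewrite in_setD1 in_neighbours => /andP[yx yU] xyG; exists y => //.
  rewrite in_setD xyG; apply/complete_graphP.
  by rewrite subUset !sub1set xU yU cards2 eq_sym yx.
rewrite /min_edge_cover cover /=; apply/forallP=> D; apply/implyP => /leq_card_edge_cover.
rewrite cardsD (setIidPr GK) card_complete_graph cU leG leq_subLR.
exact: bin2_le_extremal.
Qed.

Lemma extremal_extension (V : finType) (H : {set {set V}}) s :
    0 < s -> large_order s <= #|V| -> uniform 3 H ->
    ~~ contains_trace (matching s.+1) H -> extremal_size s #|V| <= #|H| ->
  exists (U : {set V}) (C : {set {set V}}),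
    [/\ #|U| = s + 2, min_edge_cover U (complete_graph U) C,
        H = extension U (complete_graph U :\: C) & #|H| = extremal_size s #|V|].
Proof.
move=> s0 nV H3 noT leH.
have [U [C [cU minC GE cG]]] := heavy_graph_structure s0 nV H3 noT leH.
have cE : #|extension U (complete_graph U :\: C)| = extremal_size s #|V|.
  rewrite card_extension ?subsetDl // cG cU /extremal_size.
  by rewrite subnDA.
have HE : H = extension U (complete_graph U :\: C).
  apply/eqP; rewrite eqEcard cE leH andbT.
  exact: (confinement H3 s0 noT cU minC GE).
by exists U, C; split=> //; rewrite HE.
Qed.

Lemma ex_trace_lower s n : 0 < s -> s + 2 <= n ->
  extremal_size s n <= ex_trace 3 n (matching s.+1).
Proof.
move=> s0 sn; pose U := [set x in take (s + 2) (enum 'I_n)].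
have cU : #|U| = s + 2.
  rewrite cardsE (card_uniqP _) ?take_uniq ?enum_uniq //.
  by rewrite size_take_min size_enum_ord; apply/minn_idPl.
have [|C covC leC] := @small_edge_cover _ U; first by rewrite cU addn2.
set G := complete_graph U :\: C.
have [sCK _] := edge_coverP _ _ covC.
apply: (@leq_trans #|extension U G|).
  rewrite card_extension ?subsetDl // cardsD (setIidPr sCK).
  rewrite card_complete_graph cU card_ord /extremal_size subnDA.
  rewrite leq_add2r leq_mul2r; apply/orP; right.
  by apply: extremal_le_bin2; rewrite -cU.
rewrite /ex_trace; apply: (leq_bigmax_cond (F := fun H : {set {set 'I_n}} => #|H|)).
by rewrite extension_uniform ?subsetDl //=; apply: extension_trace_free.
Qed.

Theorem theorem1p3 (s : nat) (hs : 1 <= s) :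
  exists n0 : nat, forall n : nat, n0 <= n ->
    ex_trace 3 n (matching s.+1)
      = (s * (s + 2)) %/ 2 * (n - s - 2) + 'C(s + 2, 3)
    /\
    forall (V : finType) (H : {set {set V}}),
      #|V| = n -> uniform 3 H -> ~~ contains_trace (matching s.+1) H ->
      #|H| = (s * (s + 2)) %/ 2 * (n - s - 2) + 'C(s + 2, 3) ->
      exists (U : {set V}) (C : {set {set V}}),
        [/\ #|U| = s + 2,
            min_edge_cover U (complete_graph U) C &
            H = extension U (complete_graph U :\: C)].
Proof.
exists (large_order s) => n n0; split; last first.
  move=> V H cV H3 noT cH; rewrite -cV in n0 cH.
  have [|U [C [cU minC HE _]]] := extremal_extension hs n0 H3 noT.
    by rewrite cH.
  by exists U, C.
apply/eqP; rewrite eqn_leq -/(extremal_size s n) ex_trace_lower //; last first.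
  exact: leq_trans (leq_large_order s) n0.
rewrite andbT; apply/bigmax_leqP => H /andP[H3 noT].
case/orP: (leq_total #|H| (extremal_size s n)) => // leH.
have [||U [C [_ _ _ cH]]] := extremal_extension hs _ H3 noT; rewrite ?card_ord //.
by rewrite card_ord in cH; apply: eq_leq cH.
Qed.
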